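(* Let $a(n)$ denote the number of partitions of $n$ in which every part appears with odd multiplicity. Let $m\ge 0$ be an integer and write the prime factorization of $8m+3$ as $8m+3=\prod_{i\ge1}p_i^{\beta_i}$. Then $a(8m+3)$ is odd if and only if one of the following holds: (1) $m\equiv 0\pmod 3$ and $8m+3$ is $3$ times a perfect square; or (2) $m\equiv 1\pmod 3$, and all exponents $\beta_i$ are even except for exactly one of them, which is congruent to $1\pmod 4$.
   Context: A partition of $n$ is a finite nonincreasing sequence of positive integers summing to $n$; the multiplicity of a part is the number of times it occurs. Equivalently, $\sum_{n\ge0}a(n)q^n=\prod_{i\ge1}\left(1+\frac{q^i}{1-q^{2i}}\right)$. *)

(* Defs.v *)
From mathcomp Require Import all_boot.

Set Implicit Arguments.
Unset Strict Implicit.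
Unset Printing Implicit Defensive.

Definition is_partition (n : nat) (s : seq nat) : bool :=
  [&& sorted geq s, all (ltn 0) s & sumn s == n].

Definition odd_multiplicities (s : seq nat) : bool :=
  all (fun i => odd (count_mem i s)) s.

(* A partition of n has at most n parts, each at most n, so nothing is lost by
   counting inside the finite type of sequences of length <= n with entries in
   {0, .., n}; see [num_odd_mult_partitionsE]. *)
Definition num_odd_mult_partitions (n : nat) : nat :=
  #|[set b : {bseq n of 'I_n.+1} |
      is_partition n (map val b) && odd_multiplicities (map val b)]|.

Lemma is_partition_bseq n s :
  is_partition n s -> exists b : {bseq n of 'I_n.+1}, map val b = s.
Proof.
case/and3P=> _ s_gt0 /eqP sum_s.
have s_le i : i \in s -> i < n.+1.
  rewrite ltnS -sum_s; elim: s {s_gt0 sum_s} => //= j s IHs.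
  by rewrite inE => /predU1P[->|/IHs/leq_trans->//]; rewrite (leq_addr, leq_addl).
have size_s : size s <= n.
  rewrite -sum_s; elim: s s_gt0 {sum_s s_le} => //= j s IHs /andP[j_gt0 /IHs].
  by rewrite -add1n; apply: leq_add.
have size_t : size (map (@inord n) s) <= n by rewrite size_map.
exists (Bseq size_t); rewrite /= -map_comp -[RHS]map_id.
by apply/eq_in_map => i /s_le; apply: inordK.
Qed.

Lemma num_odd_mult_partitionsE n (L : seq (seq nat)) :
    uniq L ->
    (forall s, (s \in L) = is_partition n s && odd_multiplicities s) ->
  num_odd_mult_partitions n = size L.
Proof.
move=> uL inL; rewrite /num_odd_mult_partitions cardE.
set E := enum _; pose f (b : {bseq n of 'I_n.+1}) := map val b.
have f_inj : injective f.
  by move=> b c /(inj_map val_inj)/val_inj.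
rewrite -(size_map f); apply/perm_size/uniq_perm => //.
  by rewrite map_inj_uniq ?enum_uniq.
move=> s; rewrite inL; apply/mapP/idP => [[b]|Ps].
  by rewrite mem_enum inE => Pb ->.
have [/is_partition_bseq[b def_s] _] := andP Ps.
by exists b; rewrite // mem_enum inE def_s.
Qed.

(* Main.v *)
Require Import Defs.
From mathcomp Require Import all_boot all_order all_algebra zify ring.

(** Write f_k for the product of the 1 - q^(k i).  Modulo 2 each factor
    1 + q^i / (1 - q^(2 i)) is (1 - q^(3 i)) / (1 - q^i)^3, so the generating
    function is A = g / psi with g = f_3 and psi = f_1^3.  By Gauss, psi is the
    sum of the q^(s (s + 1) / 2), and multiplying Eisenstein integers of norm
    2 n + 1 by cube roots of unity gives psi(q) psi(q^3) = psi(q^4) + q psi(q^12),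
    that is psi g^3 = psi^4 + q g^12.  Hence A = (psi / g)^2 + q (g^5 / psi)^2.
    Squares are series in q^2, so this splits A by parity of the exponent, and
    three such splittings give the coefficients of A at 8 m + 3: they form the
    series psi g^2.  With Euler's pentagonal number theorem, a(8 m + 3) has the
    parity of the number of x, y > 0 with x^2 + 2 y^2 = 8 m + 3 and 3 not
    dividing y.

    For n = 3 modulo 8 the positive solutions of x^2 + 2 y^2 = n are the fixed
    points of the swap of y and z on the solutions of x^2 + 2 y z = n.  An
    involution of the kind Zagier used for sums of two squares has there the
    fixed points (d, d, z), one for each factorisation n = d (d + 2 z).  So the
    number of representations has the parity of half the number of divisors of
    n, and the theorem follows from the multiplicativity of the latter. *)

Set Implicit Arguments.
Unset Strict Implicit.
Unset Printing Implicit Defensive.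

Import GRing.Theory.

(** * Involutions and bijections on lists *)

(** Points moved by [f] pair off as x, f x. The induction strips the head alone when it is fixed,
    and together with its image otherwise. *)
Lemma odd_size_involution (T : eqType) (f : T -> T) (s : seq T) :
    uniq s -> {in s, forall x, f x \in s} -> {in s, forall x, f (f x) = x} ->
  odd (size s) = odd (count (fun x => f x == x) s).
Proof.
have [n] := ubnP (size s); elim: n s => // n IHn [|x s] //= le_s_n.
move=> /andP[xNs us] fs ffs.
have [fx | fxNx] := eqVneq (f x) x.
  rewrite oddD [in RHS]/= -(IHn s) // => y ys; last by rewrite ffs ?inE ?ys ?orbT.
  have := fs y; rewrite !inE ys orbT => /(_ isT)/predU1P[fy | //].
  by case/negP: xNs; rewrite -fx -fy ffs ?inE ?ys ?orbT.
have fx_s : f x \in s.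
  by have := fs x; rewrite !inE eqxx (negPf fxNx) => /(_ isT).
rewrite add0n (permP (perm_to_rem fx_s)) (perm_size (perm_to_rem fx_s)) /=.
rewrite ffs ?inE ?eqxx // (eq_sym x) (negPf fxNx) add0n negbK IHn ?rem_uniq //.
- by rewrite size_rem //; case: (s) fx_s le_s_n => //= *; lia.
- move=> y; rewrite mem_rem_uniq // !inE => /andP[yNfx ys].
  have := fs y; rewrite inE ys orbT => /(_ isT); rewrite inE mem_rem_uniq // inE.
  case/predU1P => [fy | ->].
    by case/eqP: yNfx; rewrite -fy ffs ?inE ?ys ?orbT.
  rewrite andbT; apply/negP => /eqP/(congr1 f).
  by rewrite !ffs ?inE ?ys ?eqxx ?orbT // => yx; rewrite -yx ys in xNs.
by move=> y /mem_rem ys; rewrite ffs ?inE ?ys ?orbT.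
Qed.

Definition pairs (B : nat) (P : pred (nat * nat)) : seq (nat * nat) :=
  filter P [seq (x, y) | x <- iota 0 B, y <- iota 0 B].

Lemma mem_pairs B P x y : ((x, y) \in pairs B P) = [&& P (x, y), x < B & y < B].
Proof.
rewrite mem_filter; congr (_ && _).
apply/allpairsP/andP => [[[u v] /= [+ + [-> ->]]]|[xB yB]].
  by rewrite !mem_iota.
by exists (x, y); rewrite !mem_iota.
Qed.

Lemma pairs_uniq B P : uniq (pairs B P).
Proof.
by rewrite filter_uniq // allpairs_uniq ?iota_uniq // => -[? ?] [? ?].
Qed.

Lemma eq_size_bij (S T : eqType) (f : S -> T) (g : T -> S) (s : seq S) (t : seq T) :
    uniq s -> uniq t -> {in s, forall x, f x \in t} -> {in t, forall y, g y \in s} ->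
    {in s, cancel f g} -> {in t, cancel g f} ->
  size s = size t.
Proof.
move=> us ut fs gt fK gK; rewrite -(size_map f).
apply/perm_size/uniq_perm => //.
  by rewrite map_inj_in_uniq // => x y xs ys fxy; rewrite -(fK x) // fxy fK.
move=> y; apply/mapP/idP => [[x xs ->]|yt]; first exact: fs.
by exists (g y); rewrite ?gt ?gK.
Qed.

(** * Representations by x^2 + 2 y^2 *)

Definition sqr2_reps (n : nat) : seq (nat * nat) :=
  pairs n.+1 (fun p => p.1 ^ 2 + 2 * p.2 ^ 2 == n).

Definition zagier_triples (n : nat) : seq (nat * nat * nat) :=
  [seq t <- [seq (p, z) | p <- pairs n.+1 predT, z <- iota 0 n.+1]
     | t.1.1 ^ 2 + 2 * t.1.2 * t.2 == n].

(* For n = 3 modulo 8 no solution lies on the boundary between two branches: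
   2 y = x and 2 y = 3 x + 2 z are excluded as x is odd, while 2 y = 2 x + z
   and y = 2 x + 2 z make n a square. *)
Definition zagier_jackson (t : nat * nat * nat) : nat * nat * nat :=
  let: (x, y, z) := t in
  if 2 * y < x then (x - 2 * y, z + 2 * x - 2 * y, y)
  else if 2 * y < 2 * x + z then (2 * y - x, y, 2 * x + z - 2 * y)
  else if 2 * y < 3 * x + 2 * z then
    (3 * x + 2 * z - 2 * y, 2 * x + 2 * z - y, 2 * y - 2 * x - z)
  else if y < 2 * x + 2 * z then
    (2 * y - 3 * x - 2 * z, 2 * y - 2 * x - z, 2 * x + 2 * z - y)
  else (x + 2 * z, z, y - 2 * x - 2 * z).

Lemma sqr_mod8 x : x ^ 2 %% 8 = if odd x then 1 else 4 * odd x./2.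
Proof.
have def_x := odd_double_half x; have def_h := odd_double_half x./2.
set h := x./2./2 in def_h; rewrite -{1}def_x -{1}def_h -!muln2.
case: (odd x) (odd x./2) => [] [].
- by rewrite (_ : _ ^ 2 = (2 * h ^ 2 + 3 * h + 1) * 8 + 1) ?modnMDl //; rewrite expnS expn1 /=; lia.
- by rewrite (_ : _ ^ 2 = (2 * h ^ 2 + h) * 8 + 1) ?modnMDl //; rewrite expnS expn1 /=; lia.
- by rewrite (_ : _ ^ 2 = (2 * h ^ 2 + 2 * h) * 8 + 4) ?modnMDl //; rewrite expnS expn1 /=; lia.
by rewrite (_ : _ ^ 2 = (2 * h ^ 2) * 8 + 0) ?modnMDl //; rewrite expnS expn1 /=; lia.
Qed.

Lemma not_sqr_mod8 n k : n %% 8 = 3 -> k ^ 2 <> n.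
Proof.
move=> n8 kn; have := sqr_mod8 k; rewrite kn n8.
by case: (odd k); case: (odd k./2).
Qed.

Section Zagier.
Variables (n : nat) (n8 : n %% 8 = 3).

(** An even x would make n even. With y = 0 or z = 0 one gets n = x^2, and the two excluded
    equalities give n = (x + z)^2 and n = (x + 2 z)^2, but no square is 3 modulo 8. *)
Lemma zagier_bounds x y z : x ^ 2 + 2 * y * z = n ->
  [/\ odd x, 0 < y, 0 < z, 2 * y <> 2 * x + z & y <> 2 * x + 2 * z].
Proof.
move=> def_n; split.
- have := n8; rewrite -def_n -mulnA; have := sqr_mod8 x; case: (odd x) => //.
  by move: (x ^ 2) (y * z); case: odd => /=; lia.
- by case: y def_n => // def_n; case: (@not_sqr_mod8 n x) => //; lia.
- by case: z def_n => // def_n; case: (@not_sqr_mod8 n x) => //; lia.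
- by move=> e; apply: (@not_sqr_mod8 n (x + z)) => //; nia.
- by move=> e; apply: (@not_sqr_mod8 n (x + 2 * z)) => //; nia.
Qed.

Lemma mem_zagier_triples x y z :
  ((x, y, z) \in zagier_triples n) = (x ^ 2 + 2 * y * z == n).
Proof.
rewrite mem_filter; apply/andb_idr => /eqP def_n0.
have def_n : x ^ 2 + 2 * y * z = n := def_n0.
have [_ y_gt0 z_gt0 _ _] := zagier_bounds def_n.
have xy_in : (x, y) \in pairs n.+1 predT by rewrite mem_pairs /=; nia.
have z_in : z \in iota 0 n.+1 by rewrite mem_iota; nia.
by apply/allpairsP; exists ((x, y), z).
Qed.

Lemma zagier_triples_uniq : uniq (zagier_triples n).
Proof.
rewrite filter_uniq // allpairs_uniq ?iota_uniq ?pairs_uniq //.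
by move=> [? ?] [? ?].
Qed.

(** Each branch is a linear substitution preserving x^2 + 2 y z. The branch conditions make its
    truncated subtractions exact, so [ring] can check it over the integers. *)
Lemma zagier_jackson_triples :
  {in zagier_triples n, forall t, zagier_jackson t \in zagier_triples n}.
Proof.
case=> -[x y] z; rewrite mem_zagier_triples // => /eqP def_n.
have [oddx y_gt0 z_gt0 b1 b2] := zagier_bounds def_n.
rewrite /zagier_jackson; do 4?case: ltnP => ?; rewrite mem_zagier_triples -def_n;
  apply/eqP/(can_inj absz_nat); rewrite -!mulnn !(PoszD, PoszM) -?subzn; try lia;
  rewrite !(PoszD, PoszM); ring.
Qed.

(** The first and last regions are exchanged by inverse maps; each of the three middle regions is
    mapped to itself by an involution. *)
Lemma zagier_jacksonK : {in zagier_triples n, forall t, zagier_jackson (zagier_jackson t) = t}.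
Proof.
case=> -[x y] z; rewrite mem_zagier_triples // => /eqP def_n.
have [oddx y_gt0 z_gt0 b1 b2] := zagier_bounds def_n.
rewrite {2}/zagier_jackson; do 4?case: ltnP => ?; rewrite /zagier_jackson;
  do 4?case: ltnP => ?; (lia || (congr (_, _, _); lia)).
Qed.

Lemma zagier_jackson_fix x y z : x ^ 2 + 2 * y * z = n ->
  (zagier_jackson (x, y, z) == (x, y, z)) = (x == y).
Proof.
move=> def_n; have [oddx y_gt0 z_gt0 b1 b2] := zagier_bounds def_n.
(* The third branch could only fix y = x + z, where n is a sum of two squares,
   and the fourth y = 2 x + z, where n = (x + 2 z)^2 - 2 z^2. *)
have no_fix3 : y <> x + z.
  move=> def_y; have : (x + z) ^ 2 + z ^ 2 = n by rewrite -def_n def_y; ring.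
  have := sqr_mod8 (x + z); have := sqr_mod8 z.
  case: (odd z); case: (odd (x + z)); case: (odd z./2); case: (odd (x + z)./2);
    move: (z ^ 2) ((x + z) ^ 2) n8; lia.
have no_fix4 : y <> 2 * x + z.
  move=> def_y; have := sqr_mod8 (x + 2 * z); have -> : odd (x + 2 * z) by rewrite oddD oddM oddx.
  have -> : (x + 2 * z) ^ 2 = n + 2 * z ^ 2 by rewrite -def_n def_y; ring.
  by have := sqr_mod8 z; case: (odd z); case: (odd z./2); move: (z ^ 2) n8; lia.
rewrite /zagier_jackson; do 4?case: ltnP => ?; rewrite !xpair_eqE; lia.
Qed.

Lemma odd_size_sqr2_reps :
  odd (size (sqr2_reps n)) = odd (count (fun d => d ^ 2 < n) (divisors n)).
Proof.
have n_gt0 : 0 < n by lia.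
pose swap (t : nat * nat * nat) := (t.1.1, t.2, t.1.2).
transitivity (odd (size (zagier_triples n))).
  rewrite (@odd_size_involution _ swap) ?zagier_triples_uniq //; first last.
  - by case=> [[x y] z].
  - by case=> [[x y] z]; rewrite !mem_zagier_triples mulnAC.
  rewrite -size_filter; congr (odd _).
  apply: (@eq_size_bij _ _ (fun p => (p.1, p.2, p.2)) fst).
  - exact: pairs_uniq.
  - by rewrite filter_uniq ?zagier_triples_uniq.
  - case=> x y; rewrite mem_pairs mem_filter mem_zagier_triples /= => /and3P[/eqP <- _ _].
    by rewrite !eqxx /=; lia.
  - case=> [[x y] z]; rewrite mem_filter mem_zagier_triples => /andP[/eqP[-> _] /eqP def_n].
    have [oddx y_gt0 _ _ _] := zagier_bounds def_n.
    by rewrite mem_pairs /=; nia.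
  - by case.
  - by case=> [[x y] z]; rewrite mem_filter => /andP[/eqP[-> _]].
rewrite (odd_size_involution zagier_triples_uniq zagier_jackson_triples zagier_jacksonK).
rewrite -!size_filter; congr (odd _).
(* A fixed triple (d, d, z) means n = d (d + 2 z), so d is the smaller factor. Conversely the
   cofactor gives back z, as both factors of the odd n are odd. *)
apply: (@eq_size_bij _ _ (fun t => t.1.1) (fun d => (d, d, (n %/ d - d)./2))).
- by rewrite filter_uniq ?zagier_triples_uniq.
- by rewrite filter_uniq ?divisors_uniq.
- case=> [[x y] z]; rewrite mem_filter mem_zagier_triples => /andP[/[swap]/eqP def_n].
  rewrite zagier_jackson_fix // mem_filter => /eqP xy.
  have [oddx y_gt0 z_gt0 _ _] := zagier_bounds def_n.
  rewrite -dvdn_divisors //= -{2}def_n xy -mulnn -mulnA mulnCA -mulnDr dvdn_mulr // andbT.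
  by nia.
- move=> d; rewrite [d \in _]mem_filter -dvdn_divisors // => /andP[lt_d /dvdnP[e def_n]].
  have d_gt0 : 0 < d by case: d lt_d def_n => // _; rewrite muln0; lia.
  have lt_de : d < e by move: lt_d; rewrite def_n -mulnn ltn_pmul2r.
  have odd_de : odd e && odd d by rewrite -oddM -def_n; lia.
  have def_n2 : d ^ 2 + 2 * d * (e - d)./2 = n.
    rewrite (mulnC 2) -mulnA mul2n halfK oddB ?(ltnW lt_de) //.
    case/andP: odd_de => -> ->; rewrite subn0 -mulnn -mulnDr subnKC ?(ltnW lt_de) //.
    by rewrite mulnC.
  have -> : n %/ d = e by rewrite def_n mulnK.
  rewrite mem_filter mem_zagier_triples // zagier_jackson_fix // eqxx def_n2 eqxx //.
- case=> [[x y] z]; rewrite mem_filter mem_zagier_triples => /andP[/[swap]/eqP def_n].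
  rewrite zagier_jackson_fix // => /eqP xy.
  have [oddx y_gt0 z_gt0 _ _] := zagier_bounds def_n.
  rewrite /= -xy in def_n *; congr (_, _, _).
  by rewrite -def_n -mulnn -mulnA mulnCA -mulnDr mulKn; lia.
by [].
Qed.

End Zagier.

(** * The number of divisors *)

Definition tau (n : nat) : nat := size (divisors n).

(** The map d -> n / d exchanges the divisors below and above the square root of n. *)
Lemma tau_sqr_lt n : 0 < n -> (forall k, k ^ 2 <> n) ->
  tau n = 2 * count (fun d => d ^ 2 < n) (divisors n).
Proof.
move=> n_gt0 nsq; rewrite /tau -(count_predC (fun d => d ^ 2 < n)) mul2n -addnn.
congr (_ + _); rewrite -!size_filter.
have codiv d : d %| n -> [/\ 0 < d, 0 < n %/ d, n %/ d %| n & n = n %/ d * d].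
  move=> dn; have d_gt0 := dvdn_gt0 n_gt0 dn.
  split; [exact: d_gt0 | by rewrite divn_gt0 // dvdn_leq | | by rewrite divnK].
  by apply/dvdnP; exists d; rewrite mulnC divnK.
apply: (@eq_size_bij _ _ (divn n) (divn n)); rewrite ?filter_uniq ?divisors_uniq //.
- move=> d; rewrite !mem_filter -!dvdn_divisors //= -leqNgt => /andP[le_d /codiv[d0 e0 -> def_n]].
  have : d <> n %/ d by move=> e; apply: (nsq d); rewrite [RHS]def_n -e mulnn.
  by rewrite andbT; nia.
- move=> d; rewrite !mem_filter -!dvdn_divisors //= -leqNgt => /andP[le_d /codiv[d0 e0 -> def_n]].
  by rewrite andbT; nia.
- by move=> d; rewrite mem_filter -dvdn_divisors // => /andP[_ dn]; rewrite divnA ?mulKn.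
- by move=> d; rewrite mem_filter -dvdn_divisors // => /andP[_ dn]; rewrite divnA ?mulKn.
Qed.

(** The involution d -> n / d must have a fixed point, and that point is a square root of n. *)
Lemma odd_tau_sqr n : 0 < n -> odd (tau n) -> exists k, n = k ^ 2.
Proof.
move=> n_gt0; rewrite /tau (@odd_size_involution _ (divn n)) ?divisors_uniq //; first last.
- by move=> d; rewrite -dvdn_divisors // => dn; rewrite divnA ?mulKn.
- by move=> d; rewrite -!dvdn_divisors // => dn; rewrite -{2}(divnK dn) dvdn_mulr.
move/odd_gt0; rewrite -has_count => /hasP[d]; rewrite -dvdn_divisors // => dn /eqP e.
by exists d; rewrite -[LHS](divnK dn) e mulnn.
Qed.

(** Multiplication of a divisor of m by one of n is inverted by taking the gcd with m and with n. *)
Lemma tauM m n : 0 < m -> 0 < n -> coprime m n -> tau (m * n) = tau m * tau n.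
Proof.
move=> m0 n0 co_mn; rewrite /tau -(size_allpairs (fun d e => d * e)).
apply/perm_size/uniq_perm; rewrite ?divisors_uniq //.
  rewrite allpairs_uniq ?divisors_uniq // => -[d e] [d' e'].
  move=> /allpairsP[[x y] /= [+ + [-> ->]]] /allpairsP[[x' y'] /= [+ + [-> ->]]].
  rewrite -!dvdn_divisors // => xm yn xm' yn' exy.
  have gcdE a b : a %| m -> b %| n -> gcdn m (a * b) = a.
    move=> am bn; rewrite Gauss_gcdl; first exact/gcdn_idPr.
    exact: coprime_dvdr co_mn.
  have gcdE' a b : a %| m -> b %| n -> gcdn n (a * b) = b.
    move=> am bn; rewrite Gauss_gcdr; first exact/gcdn_idPr.
    by rewrite coprime_sym; apply: coprime_dvdl co_mn.
  by rewrite -(gcdE x y) // -{2}(gcdE' x y) // exy gcdE ?gcdE'.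
move=> d; rewrite -dvdn_divisors ?muln_gt0 ?m0 //; apply/idP/allpairsP => [dmn|].
  exists (gcdn m d, gcdn n d); rewrite -!dvdn_divisors // !dvdn_gcdl /=; split=> //.
  apply/eqP; rewrite eqn_dvd Gauss_dvd ?dvdn_gcdr ?andbT.
    rewrite muln_gcdl !muln_gcdr !dvdn_gcd dmn.
    by rewrite (dvdn_mull m (dvdnn d)) (dvdn_mulr n (dvdnn d)) (dvdn_mulr d (dvdnn d)).
  exact/(coprime_dvdl (dvdn_gcdl _ _))/(coprime_dvdr (dvdn_gcdl _ _)).
by case=> [[x y]] /= [+ + ->]; rewrite -!dvdn_divisors //; apply: dvdn_mul.
Qed.

Lemma tau_pfactor p k : prime p -> tau (p ^ k) = k.+1.
Proof.
move=> p_pr; have p_gt1 := prime_gt1 p_pr.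
rewrite /tau -[RHS](size_iota 0) -[RHS](size_map (expn p)).
apply/perm_size/uniq_perm; first exact: divisors_uniq.
  rewrite map_inj_uniq ?iota_uniq //; move=> i j /eqP.
  by rewrite eqn_exp2l // => /eqP.
move=> d; rewrite -dvdn_divisors ?expn_gt0 ?prime_gt0 //.
by apply/dvdn_pfactor/mapP => // -[i i_k ->]; exists i; rewrite // mem_iota in i_k *.
Qed.

Lemma tau_partn p n : prime p -> 0 < n -> tau n = (logn p n).+1 * tau n`_p^'.
Proof.
move=> p_pr n_gt0; rewrite -{1}(partnC p n_gt0) tauM ?part_gt0 ?coprime_partC //.
by rewrite p_part tau_pfactor.
Qed.

Lemma logn_partC p r n : prime p -> 0 < n -> logn r n`_p^' = if r == p then 0 else logn r n.
Proof.
move=> p_pr n_gt0; have [r_pr | /negPf rNpr] := boolP (prime r); last first.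
  by rewrite [LHS]lognE [logn r n]lognE rNpr if_same.
have [->|neq_rp] := eqVneq.
  by rewrite logn_coprime //; apply: pnat_coprime (pnat_id p_pr) (part_pnat _ _).
rewrite -[in RHS](partnC p n_gt0) p_part logn_Gauss // coprimeXr //.
by rewrite prime_coprime // dvdn_prime2.
Qed.

(** The number of divisors is the product of the exponents plus one. The converse splits off the
    smallest prime factor, by strong induction. *)
Lemma odd_tau n : 0 < n ->
  odd (tau n) <-> forall r, prime r -> ~~ odd (logn r n).
Proof.
move=> n_gt0; split=> [odd_tau r r_pr|].
  by move: odd_tau; rewrite (tau_partn r_pr) // oddM => /andP[].
have [b] := ubnP n; elim: b n n_gt0 => // b IHb n n_gt0 lt_nb even_log.
case: (ltngtP n 1) => [||-> //]; first by rewrite ltnNge n_gt0.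
move=> n_gt1; have p_pr := pdiv_prime n_gt1; set p := pdiv n in p_pr.
rewrite (tau_partn p_pr) // oddM /= even_log //=; apply: IHb; rewrite ?part_gt0 //.
  apply: (@leq_trans n); last by rewrite -ltnS.
  rewrite -[n in _ < n](partnC p n_gt0).
  rewrite ltn_Pmull ?part_gt0 // p_part -(expn0 p) ltn_exp2l ?prime_gt1 //.
  by rewrite logn_gt0 mem_primes p_pr n_gt0 pdiv_dvd.
by move=> r r_pr; rewrite logn_partC //; case: eqP => // _; apply: even_log.
Qed.

(** A product of the numbers e + 1 is 2 modulo 4 when exactly one of them is even and that one is
    itself 2 modulo 4, that is e = 1 modulo 4. *)
Lemma tau_mod4 n : 0 < n ->
  tau n %% 4 = 2 <->
  exists p, [/\ prime p, logn p n = 1 %[mod 4] &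
    forall r, prime r -> r <> p -> ~~ odd (logn r n)].
Proof.
move=> n_gt0; split=> [tau2|[p [p_pr log_p even_log]]].
  have [p p_pr odd_log] : exists2 p, prime p & odd (logn p n).
    have /hasP[p + odd_p] : has (fun p => odd (logn p n)) (primes n).
      apply: contraPT tau2 => /hasPn even_log.
      suff: odd (tau n) by lia.
      apply/odd_tau => // r r_pr; have [rn|] := boolP (r \in primes n).
        exact: even_log.
      by rewrite -logn_gt0 -eqn0Ngt => /eqP->.
    by rewrite mem_primes => /and3P[p_pr _ _]; exists p.
  move: tau2; rewrite (tau_partn p_pr) // => tau2.
  have odd_tau' : odd (tau n`_p^').
    move: tau2 odd_log; move: (logn p n) (tau _) => a c.
    rewrite -[a]odd_double_half -[c]odd_double_half -!muln2.
    by case: (odd a); case: (odd c) => //; move: (a./2) (c./2) => u v; nia.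
  exists p; split=> //.
    move: tau2 odd_log odd_tau'; move: (logn p n) (tau _) => a c.
    rewrite -[a]odd_double_half -[c]odd_double_half -!muln2.
    by case: (odd a); case: (odd c) => //; move: (a./2) (c./2) => u v; nia.
  move=> r r_pr /eqP/negPf neq_rp.
  have /odd_tau/(_ r r_pr) := odd_tau'; rewrite part_gt0 logn_partC // neq_rp.
  by apply.
have odd_tau' : odd (tau n`_p^').
  apply/odd_tau; rewrite ?part_gt0 // => r r_pr; rewrite logn_partC //.
  by case: eqP => // neq_rp; apply: even_log.
rewrite (tau_partn p_pr) //; move: log_p odd_tau'; move: (logn p n) (tau _) => a c.
move=> log_a odd_c; rewrite -[c]odd_double_half odd_c -muln2.
rewrite (divn_eq a 4) log_a; move: (c./2) (a %/ 4) => u v.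
by rewrite (_ : _ * _ = (2 * v * u + v + u) * 4 + 2) ?modnMDl //; lia.
Qed.

(** Write n = 3^e n' with n' prime to 3: the product is odd when e is odd and n' is a square j^2,
    and then k = 3^((e - 1) / 2) j. *)
Lemma odd_tau_3sqr n : n %% 8 = 3 -> 3 %| n ->
  odd (logn 3 n * tau n`_3^') <-> exists k, n = 3 * k ^ 2.
Proof.
move=> n8 n3; have n_gt0 : 0 < n by lia.
split=> [|[k def_n]].
  rewrite oddM => /andP[odd_e /odd_tau_sqr[|j def_n']]; first exact: part_gt0.
  exists (3 ^ (logn 3 n)./2 * j).
  rewrite expnMn -expnM muln2 mulnA -def_n' -expnS -[in LHS](partnC 3 n_gt0) p_part.
  by rewrite -[in LHS](odd_double_half (logn 3 n)) odd_e.
have k_gt0 : 0 < k by case: k def_n n_gt0 => // ->.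
have logE r : prime r -> logn r n = (r == 3) + 2 * logn r k.
  by move=> r_pr; rewrite def_n lognM ?expn_gt0 ?k_gt0 // lognX logn_prime // eq_sym.
rewrite oddM logE //= oddM /=; apply/odd_tau; rewrite ?part_gt0 // => r r_pr.
by rewrite logn_partC //; case: eqP => // /eqP/negPf r3; rewrite logE // r3 oddM.
Qed.

(** * Solutions with y prime to 3 *)

(** The condition comes from the pentagonal exponents (y^2 - 1) / 24, where y is prime to 6; for n =
    3 modulo 8 the oddness of y is automatic. *)
Definition sqr2_reps_ndvd3 (n : nat) : seq (nat * nat) :=
  filter (fun p => ~~ (3 %| p.2)) (sqr2_reps n).

Lemma mem_sqr2_reps n x y : 0 < n ->
  ((x, y) \in sqr2_reps n) = (x ^ 2 + 2 * y ^ 2 == n).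
Proof.
by move=> n_gt0; rewrite mem_pairs /=; apply/andb_idr => /eqP; nia.
Qed.

Lemma sqr2_reps_uniq n : uniq (sqr2_reps n).
Proof. exact: pairs_uniq. Qed.

Lemma sqr_mod3 x : x ^ 2 %% 3 = ~~ (3 %| x).
Proof.
rewrite /dvdn -modnXm; have := ltn_pmod x (isT : 0 < 3).
by case: (x %% 3) => [|[|[|]]].
Qed.

Lemma tau_half n : n %% 8 = 3 ->
  exists2 c, tau n = 2 * c & odd (size (sqr2_reps n)) = odd c.
Proof.
move=> n8; exists (count (fun d => d ^ 2 < n) (divisors n)).
  by apply: tau_sqr_lt => [|k]; [lia | apply: not_sqr_mod8].
exact: odd_size_sqr2_reps.
Qed.

(** Since 3 divides n, it divides x as soon as it divides y, and both coordinates can be divided by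
    3. *)
Lemma size_sqr2_reps_dvd3 n : n %% 8 = 3 -> 3 %| n ->
  size (filter (fun p => 3 %| p.2) (sqr2_reps n)) = if 9 %| n then size (sqr2_reps (n %/ 9)) else 0.
Proof.
move=> n8 n3; have n_gt0 : 0 < n by lia.
have dvd3x x y : x ^ 2 + 2 * y ^ 2 = n -> 3 %| y -> 3 %| x.
  move=> def_n y3; have := sqr_mod3 x; have := sqr_mod3 y; rewrite y3.
  by case: (3 %| x) => //; move: (x ^ 2) (y ^ 2) def_n; lia.
have [/dvdnP[n' def_n'] | n9] := ifP; last first.
  apply/eqP; rewrite size_eq0 -[_ == _]negbK -has_filter; apply/hasPn => -[x y].
  rewrite mem_sqr2_reps //= => /eqP def_n; apply: contraFN n9 => y3.
  have /dvdnP[u xu] := dvd3x x y def_n y3; have /dvdnP[v yv] := y3.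
  by apply/dvdnP; exists (u ^ 2 + 2 * v ^ 2); rewrite -def_n xu yv; ring.
have n'_gt0 : 0 < n' by lia.
rewrite {2}def_n' mulnK //; symmetry.
apply: (@eq_size_bij _ _ (fun p => (3 * p.1, 3 * p.2)) (fun p => (p.1 %/ 3, p.2 %/ 3))).
- exact: sqr2_reps_uniq.
- by rewrite filter_uniq ?sqr2_reps_uniq.
- case=> x y; rewrite mem_sqr2_reps // => /eqP def_n.
  by rewrite mem_filter /= dvdn_mulr // mem_sqr2_reps // def_n' -def_n; apply/eqP; ring.
- case=> x y; rewrite mem_filter mem_sqr2_reps //= => /andP[y3 /eqP def_n].
  have /dvdnP[u xu] := dvd3x x y def_n y3; have /dvdnP[v yv] := y3.
  rewrite xu yv !mulnK // mem_sqr2_reps //.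
  by rewrite -(eqn_pmul2r (isT : 0 < 9)) -def_n' -def_n xu yv; apply/eqP; ring.
- by case=> x y _; rewrite /= !mulKn.
- case=> x y; rewrite mem_filter mem_sqr2_reps //= => /andP[y3 /eqP def_n].
  have /dvdnP[u xu] := dvd3x x y def_n y3; have /dvdnP[v yv] := y3.
  by rewrite xu yv !mulnK // ![3 * _]mulnC.
Qed.

(** Let n = 3^e n' with n' prime to 3. All solutions count as (e + 1) tau(n') / 2 modulo 2, and
    those with 3 dividing y, which come from n / 9, as (e - 1) tau(n') / 2; the two add up to e
    tau(n'). For e = 1 the second count is zero. *)
Lemma odd_sqr2_reps_ndvd3_dvd3 n : n %% 8 = 3 -> 3 %| n ->
  odd (size (sqr2_reps_ndvd3 n)) = odd (logn 3 n * tau n`_3^').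
Proof.
move=> n8 n3; have n_gt0 : 0 < n by lia.
have e_gt0 : 0 < logn 3 n by rewrite logn_gt0 mem_primes n_gt0.
have [c tau_c odd_c] := tau_half n8.
have := tau_partn (isT : prime 3) n_gt0; rewrite tau_c => def_c.
have -> : odd (size (sqr2_reps_ndvd3 n)) =
    odd c (+) odd (size (filter (fun p => 3 %| p.2) (sqr2_reps n))).
  rewrite -odd_c -(count_predC (fun p => 3 %| p.2) (sqr2_reps n)) oddD.
  by rewrite -!size_filter addbAC addbb.
rewrite size_sqr2_reps_dvd3 //; have [n9 | n9] := ifP; last first.
  have e1 : logn 3 n = 1.
    apply/eqP; rewrite eqn_leq e_gt0 andbT leqNgt; apply: contraFN n9 => e2.
    by rewrite -[9]/(3 ^ 2) pfactor_dvdn.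
  by rewrite addbF; congr odd; rewrite e1 in def_c *; lia.
have n8' : (n %/ 9) %% 8 = 3 by move/dvdnP: n9 n8 => [k ->]; rewrite mulnK //; lia.
have n'_gt0 : 0 < n %/ 9 by lia.
have [c' tau_c' ->] := tau_half n8'.
have := tau_partn (isT : prime 3) n'_gt0; rewrite tau_c'.
have -> : (n %/ 9)`_3^' = n`_3^'.
  by rewrite -[in RHS](divnK n9) partnM // [9`_3^']part_p'nat ?muln1.
have -> : logn 3 (n %/ 9) = logn 3 n - 2 by rewrite -{2}(divnK n9) lognM // addnK.
have e_ge2 : 2 <= logn 3 n by rewrite -pfactor_dvdn.
move=> def_c'; rewrite -oddD; congr odd; nia.
Qed.

(** Squares are 0 or 1 modulo 3. Hence there is no solution with y prime to 3 when n = 1 modulo 3,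
    while every solution has y prime to 3 when n = 2, where half of tau(n) must be odd. *)
Lemma odd_sqr2_reps_ndvd3 n : n %% 8 = 3 ->
  odd (size (sqr2_reps_ndvd3 n)) <->
    (n %% 3 = 0 /\ exists k, n = 3 * k ^ 2) \/
    (n %% 3 = 2 /\ exists p, [/\ prime p, logn p n = 1 %[mod 4] &
                      forall r, prime r -> r <> p -> ~~ odd (logn r n)]).
Proof.
move=> n8; have n_gt0 : 0 < n by lia.
have [n3 | n3 | n3] : [\/ n %% 3 = 0, n %% 3 = 1 | n %% 3 = 2].
- by have := ltn_pmod n (isT : 0 < 3); case: (n %% 3) => [|[|[|]]] // _; constructor.
- rewrite odd_sqr2_reps_ndvd3_dvd3 //; last exact/eqP.
  have -> := odd_tau_3sqr n8 (introT eqP n3); rewrite n3.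
  by split=> [?|[[]|[]]]; [left| |].
- have -> : sqr2_reps_ndvd3 n = [::].
    apply/eqP; rewrite -[_ == _]negbK -has_filter; apply/hasPn => -[x y].
    rewrite mem_sqr2_reps //= => /eqP def_n; have := sqr_mod3 x; have := sqr_mod3 y.
    by case: (3 %| x); case: (3 %| y) => //; move: (x ^ 2) (y ^ 2) def_n; lia.
  by rewrite n3; split=> // -[] [].
have -> : sqr2_reps_ndvd3 n = sqr2_reps n.
  apply/all_filterP/allP => -[x y]; rewrite mem_sqr2_reps //= => /eqP def_n.
  have := sqr_mod3 x; have := sqr_mod3 y.
  by case: (3 %| x); case: (3 %| y) => //; move: (x ^ 2) (y ^ 2) def_n; lia.
have [c tau_c odd_c] := tau_half n8; rewrite n3; split=> [odd_r | [[]//|[_ /(tau_mod4 n_gt0)]]].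
  right; split=> //; apply/tau_mod4 => //; rewrite tau_c.
  by move: odd_r; rewrite odd_c; lia.
by rewrite tau_c odd_c; lia.
Qed.

(** * Representations by x^2 + 3 y^2 *)

(* For x and y odd, x + y sqrt(-3) is twice an Eisenstein integer, and exactly
   one of its products by the three cube roots of unity has even coordinates;
   the map exchanges the other two, up to signs. *)
Definition eis_refl (t : nat * nat) : nat * nat :=
  let: (x, y) := t in
  if x %% 4 == y %% 4 then (((x - 3 * y) + (3 * y - x))./2, (x + y)./2)
  else ((x + 3 * y)./2, ((x - y) + (y - x))./2).

Definition sqr3_reps (B n : nat) : seq (nat * nat) :=
  pairs B (fun t => [&& odd t.1, odd t.2 & t.1 ^ 2 + 3 * t.2 ^ 2 == n]).

Section EisRefl.
Variables (B n : nat) (ltnB : 8 * n + 4 < B).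

Lemma mem_sqr3_reps x y :
  ((x, y) \in sqr3_reps B (8 * n + 4)) = [&& odd x, odd y & x ^ 2 + 3 * y ^ 2 == 8 * n + 4].
Proof.
rewrite mem_pairs /=; apply/andb_idr => /and3P[ox oy /eqP def_n].
by have := odd_gt0 ox; have := odd_gt0 oy; nia.
Qed.

(** The sum of the two opposite truncated differences is an absolute value. The test modulo 4
    selects the product by a sixth root of unity whose coordinates are odd. *)
Lemma eis_reflP x y : odd x -> odd y ->
  let: (u, v) := eis_refl (x, y) in
  [/\ odd u, odd v & u ^ 2 + 3 * v ^ 2 = x ^ 2 + 3 * y ^ 2].
Proof.
move=> ox oy; rewrite /eis_refl; case: eqP => xy4; split; try lia.
  have [u def_u] : exists u, x + y = 2 * u by exists (x + y)./2; lia.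
  have [lexy|ltxy] := leqP (3 * y) x.
    have [v def_v] : exists v, x = 3 * y + 2 * v by exists (x - 3 * y)./2; lia.
    have -> : (x - 3 * y + (3 * y - x))./2 = v by lia.
    have -> : (x + y)./2 = 2 * y + v by lia.
    by rewrite def_v; ring.
  have -> : (x + y)./2 = u by lia.
  have -> : (x - 3 * y + (3 * y - x))./2 = 2 * y - u by lia.
  have -> : x = 2 * u - y by lia.
  apply/(can_inj absz_nat); rewrite -!mulnn !(PoszD, PoszM) -!subzn; lia.
have [le_xy|lt_xy] := leqP x y.
  have [v def_v] : exists v, y = x + 2 * v by exists (y - x)./2; lia.
  have -> : (x - y + (y - x))./2 = v by lia.
  have -> : (x + 3 * y)./2 = 2 * x + 3 * v by lia.
  by rewrite def_v; ring.
have [v def_v] : exists v, x = y + 2 * v by exists (x - y)./2; lia.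
have -> : (x - y + (y - x))./2 = v by lia.
have -> : (x + 3 * y)./2 = 2 * y + v by lia.
by rewrite def_v; ring.
Qed.

Lemma eis_reflK x y : odd x -> odd y -> eis_refl (eis_refl (x, y)) = (x, y).
Proof.
move=> ox oy; rewrite [eis_refl (x, y)]/eis_refl; case: eqP => xy4; rewrite /eis_refl.
  by case: eqP => uv4; congr pair; lia.
by case: eqP => uv4; congr pair; lia.
Qed.

Lemma eis_refl_fix x y : odd x -> odd y ->
  (eis_refl (x, y) == (x, y)) = (x == y) || (x == 3 * y).
Proof.
by move=> ox oy; rewrite /eis_refl; case: ifP => /eqP xy4; rewrite xpair_eqE; lia.
Qed.

(** Fixed points have x = y or x = 3 y, where x^2 + 3 y^2 is 4 x^2 or 12 y^2. These are the terms of
    psi(q^4) and q psi(q^12). *)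
Lemma odd_sqr3_reps :
  odd (size (sqr3_reps B (8 * n + 4))) =
  odd (count (fun x => odd x && (x ^ 2 == 2 * n + 1)) (iota 0 B))
  (+) odd (count (fun y => odd y && (3 * y ^ 2 == 2 * n + 1)) (iota 0 B)).
Proof.
rewrite (@odd_size_involution _ eis_refl) ?pairs_uniq //; first last.
- by case=> x y; rewrite mem_sqr3_reps => /and3P[ox oy _]; apply: eis_reflK.
- case=> x y; rewrite mem_sqr3_reps => /and3P[ox oy /eqP def_n].
  have := eis_reflP ox oy; case: eis_refl => u v [ou ov def_n'].
  by rewrite mem_sqr3_reps ou ov def_n' def_n eqxx.
rewrite -oddD; congr odd.
transitivity (count (fun t => t.1 == t.2) (sqr3_reps B (8 * n + 4)) +
              count (fun t => t.1 == 3 * t.2) (sqr3_reps B (8 * n + 4))).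
  rewrite -count_predUI [X in _ = _ + X](_ : _ = 0) ?addn0.
    apply: eq_in_count => -[x y]; rewrite mem_sqr3_reps => /and3P[ox oy _].
    exact: eis_refl_fix.
  apply/eqP; rewrite -leqn0 leqNgt -has_count; apply/hasPn => -[x y] /=.
  by rewrite mem_sqr3_reps => /and3P[/odd_gt0 x0 /odd_gt0 y0 _] /=; lia.
congr (_ + _); rewrite -!size_filter.
  apply: (@eq_size_bij _ _ fst (fun x => (x, x))).
  - by rewrite filter_uniq ?pairs_uniq.
  - by rewrite filter_uniq ?iota_uniq.
  - case=> x y; rewrite mem_filter mem_sqr3_reps /= => /and4P[/eqP<- ox _ /eqP def_n].
    by rewrite mem_filter mem_iota ox /=; nia.
  - move=> x; rewrite mem_filter mem_iota => /andP[/andP[ox /eqP def_n] _].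
    by rewrite mem_filter mem_sqr3_reps eqxx ox def_n; apply/eqP; lia.
  - by case=> x y; rewrite mem_filter => /andP[/eqP /= <-].
  - by [].
apply: (@eq_size_bij _ _ snd (fun y => (3 * y, y))).
- by rewrite filter_uniq ?pairs_uniq.
- by rewrite filter_uniq ?iota_uniq.
- case=> x y; rewrite mem_filter mem_sqr3_reps /= => /and4P[/eqP-> _ oy /eqP def_n].
  by rewrite mem_filter mem_iota oy /=; nia.
- move=> y; rewrite mem_filter mem_iota => /andP[/andP[oy /eqP def_n] _].
  rewrite mem_filter mem_sqr3_reps eqxx oddM oy expnMn; apply/eqP; lia.
- by case=> x y; rewrite mem_filter => /andP[/eqP /= <-].
- by [].
Qed.

End EisRefl.

(** * Enumeration of the partitions with odd multiplicities *)

(* The parts are at most k, and k occurs 2 t + 1 times; the cutoff t < N loses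
   nothing when n < N. *)
Fixpoint odd_parts (N k n : nat) : seq (seq nat) :=
  if k is k'.+1 then
    odd_parts N k' n ++
    [seq nseq t.*2.+1 k ++ s | t <- iota 0 N,
       s <- if t.*2.+1 * k <= n then odd_parts N k' (n - t.*2.+1 * k) else [::]]
  else if n == 0 then [:: [::]] else [::].

Definition odd_part (k n : nat) (s : seq nat) : bool :=
  [&& is_partition n s, odd_multiplicities s & all (leq^~ k) s].

Lemma sorted_geq_split i s : sorted geq s -> all (leq^~ i) s ->
  s = nseq (count_mem i s) i ++ filter (predC1 i) s.
Proof.
elim: s => //= x s IHs xs /andP[le_xi le_si].
have [->|ne_xi] := eqVneq x i; first by rewrite /= -IHs // (path_sorted xs).
have lt_si : all (ltn^~ i) s.
  apply/allP => y ys; have := order_path_min (rev_trans leq_trans) xs.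
  by move=> /allP/(_ y ys) /=; move/eqP: ne_xi; lia.
have -> : count_mem i s = 0.
  by apply/eqP; rewrite -leqn0 leqNgt -has_count; apply/hasPn => y /(allP lt_si) /=; lia.
congr cons; apply/esym/all_filterP/allP => y /(allP lt_si) /=; lia.
Qed.

Lemma odd_part_notin k n s : odd_part k n s -> k.+1 \notin s.
Proof. by case/and3P=> _ _ /allP le_sk; apply/negP => /le_sk; rewrite ltnn. Qed.

Lemma odd_part_cat k m n s : odd m -> odd_part k n s ->
  odd_part k.+1 (m * k.+1 + n) (nseq m k.+1 ++ s).
Proof.
move=> om Ps; have ks := odd_part_notin Ps.
case/and3P: Ps => /and3P[sorted_s s_gt0 /eqP sum_s] odd_s le_sk.
apply/and3P; split.
- apply/and3P; split.
  + elim: (m) => // j IHj; rewrite /= (path_sortedE (rev_trans leq_trans)) IHj andbT.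
    rewrite all_cat all_nseq /= leqnn orbT; apply: sub_all le_sk => y /=; exact: leqW.
  + by rewrite all_cat all_nseq /= orbT.
  + by rewrite sumn_cat sumn_nseq sum_s mulnC.
- rewrite /odd_multiplicities all_cat all_nseq count_cat count_nseq /= eqxx mul1n.
  rewrite (count_memPn ks) addn0 om orbT /=.
  apply/allP => y ys; rewrite count_cat count_nseq /=.
  case: eqP => [ky|_]; first by rewrite ky ys in ks.
  by rewrite add0n (allP odd_s).
by rewrite all_cat all_nseq /= leqnn orbT; apply: sub_all le_sk => y; apply: leqW.
Qed.

Lemma odd_partS k n s : odd_part k n s -> odd_part k.+1 n s.
Proof.
by case/and3P=> ? ? le_sk; apply/and3P; split=> //; apply: sub_all le_sk => y; apply: leqW.
Qed.

Lemma odd_part_split k n s (m := count_mem k.+1 s) (s' := filter (predC1 k.+1) s) :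
    odd_part k.+1 n s ->
  [/\ s = nseq m k.+1 ++ s', m * k.+1 <= n, odd m || (m == 0) & odd_part k (n - m * k.+1) s'].
Proof.
case/and3P=> /and3P[sorted_s s_gt0 /eqP sum_s] odd_s le_sk.
have def_s := sorted_geq_split sorted_s le_sk; rewrite -/m -/s' in def_s.
have sum_s' : m * k.+1 + sumn s' = n by rewrite -sum_s [in RHS]def_s sumn_cat sumn_nseq mulnC.
split=> //; first by rewrite -sum_s' leq_addr.
  case: (posnP m) => [->|m0]; first by rewrite orbT.
  by rewrite (allP odd_s) // -has_pred1 has_count.
apply/and3P; split; first (apply/and3P; split).
- by apply: sorted_filter sorted_s; apply: rev_trans leq_trans.
- by rewrite all_filter; apply: sub_all s_gt0 => y /= ->; rewrite implybT.
- by apply/eqP; lia.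
- apply/allP => y; rewrite mem_filter /= => /andP[yk ys].
  have := allP odd_s y ys; rewrite /= [in count_mem y s]def_s.
  by rewrite count_cat count_nseq /= eq_sym (negPf yk).
rewrite all_filter; apply: sub_all le_sk => y /=; apply/implyP; lia.
Qed.

Lemma mem_odd_parts N k n s : n < N -> (s \in odd_parts N k n) = odd_part k n s.
Proof.
elim: k n s => [|k IHk] n s ltnN.
  rewrite /=; case: s => [|x s]; first by rewrite /odd_part /is_partition /= eq_sym; case: eqP.
  have -> : odd_part 0 n (x :: s) = false.
    by rewrite /odd_part /is_partition /=; case: x => [|x]; rewrite /= ?andbF.
  by case: ifP.
rewrite [odd_parts N k.+1 n]/= mem_cat IHk //; apply/orP/idP => [[|]|Ps].
- exact: odd_partS.
- case/allpairsPdep=> t [s' [t_in]]; case: ifP => // le_n; rewrite IHk; last by lia.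
  move=> Ps' ->; rewrite -[n](subnKC le_n); apply: odd_part_cat => //=.
  by rewrite odd_double.
have [def_s le_mn odd_m Ps'] := odd_part_split Ps.
case/orP: odd_m => [odd_m | /eqP m0]; last first.
  by left; rewrite def_s m0; move: Ps'; rewrite m0 subn0.
right; apply/allpairsPdep; exists (count_mem k.+1 s)./2, (filter (predC1 k.+1) s).
have def_m : (count_mem k.+1 s)./2.*2.+1 = count_mem k.+1 s.
  by rewrite -[RHS]odd_double_half odd_m.
split; [|by rewrite def_m le_mn IHk //; lia | by rewrite [LHS]def_s -[in LHS]def_m].
by rewrite mem_iota; move: le_mn; move: (count_mem _ s); nia.
Qed.

(** The two blocks differ in whether k + 1 occurs, and within the second its multiplicity gives back
    t. *)
Lemma odd_parts_uniq N k n : n < N -> uniq (odd_parts N k n).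
Proof.
elim: k n => [|k IHk] n ltnN /=; first by case: ifP.
rewrite cat_uniq IHk //=; apply/andP; split.
  apply/hasPn => s /allpairsPdep[t [s' [_ _ ->]]]; rewrite mem_odd_parts //.
  by apply/negP => /odd_part_notin; rewrite in_cons eqxx.
apply: allpairs_uniq_dep; first exact: iota_uniq.
  by move=> t _; case: ifP => // le_n; apply: IHk; lia.
have no_k t s : s \in (if t.*2.+1 * k.+1 <= n then odd_parts N k (n - t.*2.+1 * k.+1) else [::]) ->
    k.+1 \notin s.
  by case: ifP => // le_n; rewrite mem_odd_parts; [apply: odd_part_notin | lia].
move=> u v /allpairsPdep[t [s [_ /no_k ks ->]]] /allpairsPdep[t' [s' [_ /no_k ks' ->]]].
rewrite -[LHS]/(nseq t.*2.+1 k.+1 ++ s) -[RHS]/(nseq t'.*2.+1 k.+1 ++ s') => eq_s.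
have /(congr1 (count_mem k.+1)) := eq_s.
rewrite !count_cat !count_nseq /= eqxx !mul1n (count_memPn ks) (count_memPn ks') !addn0.
move=> [/double_inj eq_t]; rewrite eq_t in eq_s *.
by move/eqP: eq_s; rewrite eqseq_cat // => /andP[_ /eqP ->].
Qed.

Lemma size_odd_parts N k n : n < N -> n <= k ->
  size (odd_parts N k n) = num_odd_mult_partitions n.
Proof.
move=> ltnN lenk; apply/esym/num_odd_mult_partitionsE; first exact: odd_parts_uniq.
move=> s; rewrite mem_odd_parts // /odd_part andbA andb_idr // => /andP[/and3P[_ _ /eqP sum_s] _].
rewrite -{}sum_s in lenk; elim: s lenk => //= x s IHs le_k.
by rewrite (leq_trans (leq_addr _ _) le_k) IHs // (leq_trans (leq_addl _ _) le_k).
Qed.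

(** * Theta series modulo 2 *)

Definition tri (s : nat) : nat := (s * s.+1)./2.

Arguments tri : simpl never.

Lemma triS s : tri s.+1 = (tri s + s.+1)%N.
Proof.
rewrite /tri (_ : s.+1 * s.+2 = s * s.+1 + s.+1.*2)%N; last by rewrite -mul2n; ring.
by rewrite halfD odd_double andbF add0n doubleK.
Qed.

Section PowerSeriesModTwo.

Local Open Scope ring_scope.

(** * Polynomials over the field with two elements, modulo powers of X *)

Section PolyF2.
Implicit Types (p q r : {poly 'F_2}) (N : nat).

Lemma addpp p : p + p = 0.
Proof. by rewrite -mulr2n -mulr_natl -polyC_natr (_ : 2%:R = 0) ?mul0r //; apply/val_inj. Qed.

(** Lets [ring] prove identities special to characteristic 2: the terms that cancel are supplied
    once, as [r]. *)
Lemma eq_add2 p q r : p = q + (r + r) -> p = q.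
Proof. by rewrite addpp addr0. Qed.

Lemma natrF2 n : n%:R = (odd n)%:R :> 'F_2.
Proof. by apply/val_inj; rewrite /= !val_Fp_nat // !modn2 oddb. Qed.

(** Frobenius: cross terms occur twice, and c^2 = c for the coefficients. *)
Lemma sqrpE p : p ^+ 2 = p \Po 'X^2.
Proof.
elim/poly_ind: p => [|p c IHp]; first by rewrite comp_poly0 expr0n.
have c2 : c ^+ 2 = c by case: c => [[|[|[]]]] lt //; apply: val_inj.
rewrite comp_polyD comp_polyM comp_polyX comp_polyC -IHp -{2}c2 polyC_exp.
apply: (@eq_add2 _ _ (p * 'X * c%:P)); ring.
Qed.

Lemma comp_polyXnXn a b : 'X^a \Po 'X^b = 'X^(b * a) :> {poly 'F_2}.
Proof. by rewrite comp_Xn_poly -exprM. Qed.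

(** Polynomials compared up to precision N stand in for power series. *)
Definition eqmX N p q := 'X^N %| p - q.

Lemma eqmXxx N p : eqmX N p p.
Proof. by rewrite /eqmX subrr dvdp0. Qed.

Lemma eqmX_sym N p q : eqmX N p q -> eqmX N q p.
Proof. by rewrite /eqmX -opprB dvdpNr. Qed.

Lemma eqmX_trans N q p r : eqmX N p q -> eqmX N q r -> eqmX N p r.
Proof. by move=> pq qr; rewrite /eqmX -(subrKA q) dvdp_add. Qed.

Lemma eqmXD N p p' q q' : eqmX N p p' -> eqmX N q q' -> eqmX N (p + q) (p' + q').
Proof. by move=> pp qq; rewrite /eqmX opprD addrACA dvdp_add. Qed.

Lemma eqmXM N p p' q q' : eqmX N p p' -> eqmX N q q' -> eqmX N (p * q) (p' * q').
Proof.
move=> pp qq; rewrite /eqmX (_ : _ - _ = (p - p') * q + p' * (q - q')); last by ring.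
by apply: dvdp_add; [apply: dvdp_mulr | apply: dvdp_mull].
Qed.

Lemma eqmXX N p q k : eqmX N p q -> eqmX N (p ^+ k) (q ^+ k).
Proof.
by move=> pq; elim: k => [|k IHk]; rewrite ?expr0 ?eqmXxx // !exprS eqmXM.
Qed.

Lemma eqmX_leq M N p q : (M <= N)%N -> eqmX N p q -> eqmX M p q.
Proof. by move=> leMN; apply: dvdp_trans; rewrite dvdp_exp2l. Qed.

Lemma eqmXP N p q : reflect (forall i, (i < N)%N -> p`_i = q`_i) (eqmX N p q).
Proof.
apply: (iffP idP) => [/dvdpP[r def_r] i ltiN | eq_pq].
  by apply/eqP; rewrite -subr_eq0 -coefB def_r coefMXn ltiN.
rewrite /eqmX /dvdp -Pdiv.IdomainMonic.take_poly_modp.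
apply/eqP/polyP => i; rewrite coef_take_poly coef0 coefB.
by case: ifP => // /eq_pq ->; rewrite subrr.
Qed.

Lemma eqmX_comp k N p q : eqmX N p q -> eqmX (k * N) (p \Po 'X^k) (q \Po 'X^k).
Proof. by move/(dvdp_comp_poly 'X^k); rewrite comp_polyXnXn comp_polyB. Qed.

Lemma coprimepXn N r : r`_0 = 1 -> coprimep 'X^N r.
Proof.
move=> r0; rewrite coprimep_expl // coprimep_sym -['X]subr0 -polyC0 coprimep_XsubC.
by rewrite /root horner_coef0 r0 oner_eq0.
Qed.

Lemma eqmX_cancel N r p q : r`_0 = 1 -> eqmX N (r * p) (r * q) -> eqmX N p q.
Proof. by move=> r0; rewrite /eqmX -mulrBr Gauss_dvdpr ?coprimepXn. Qed.

(** A Bezout relation between X^N and r provides the inverse series up to precision N. *)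
Lemma eqmX_inv N r : r`_0 = 1 -> exists s, eqmX N (r * s) 1.
Proof.
move=> r0; have /Bezout_eq1_coprimepP[[u v] /= uv] := coprimepXn N r0.
exists v; rewrite /eqmX -uv mulrC opprD addrCA subrr addr0 dvdpNr dvdp_mull //.
Qed.

Lemma eqmX_sum_range N (P : pred nat) (e : nat -> nat) B C :
  (forall x, (B <= x)%N -> P x -> (N <= e x)%N) -> (B <= C)%N ->
  eqmX N (\sum_(0 <= x < C | P x) 'X^(e x)) (\sum_(0 <= x < B | P x) 'X^(e x)).
Proof.
move=> big_e leBC; rewrite (big_cat_nat (n := B)) //= -[X in eqmX _ _ X]addr0.
apply: eqmXD; first exact: eqmXxx.
rewrite big_nat_cond; elim/big_ind: _ => [|p q ? ?|x /andP[/andP[leBx _] Px]].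
- exact: eqmXxx.
- by rewrite -[0]addr0 eqmXD.
by rewrite /eqmX subr0 dvdp_exp2l // big_e.
Qed.

Lemma coef_sumXn (P : pred nat) (e : nat -> nat) B n :
  (\sum_(0 <= x < B | P x) 'X^(e x) : {poly 'F_2})`_n =
    (count (fun x => P x && (e x == n)) (iota 0 B))%:R.
Proof.
rewrite coef_sum -sum1_count natr_sum [RHS]big_mkcondr /index_iota subn0.
by apply: eq_bigr => x _; rewrite coefXn eq_sym; case: eqP.
Qed.

Lemma coef_sumXnM (P Q : pred nat) (e f : nat -> nat) B n :
  ((\sum_(0 <= x < B | P x) 'X^(e x)) * (\sum_(0 <= x < B | Q x) 'X^(f x)) : {poly 'F_2})`_n =
    (size (pairs B (fun t => [&& P t.1, Q t.2 & (e t.1 + f t.2 == n)%N])))%:R.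
Proof.
rewrite size_filter -sum1_count natr_sum [in RHS]big_mkcond /= big_allpairs_dep.
rewrite mulr_suml coef_sum [in LHS]big_mkcond /index_iota subn0 /=.
apply: eq_bigr => x _ /=; rewrite mulr_sumr coef_sum.
case: (P x) => /=; last by rewrite big1.
rewrite big_mkcond; apply: eq_bigr => y _ /=; rewrite -exprD coefXn eq_sym.
by case: (Q y) => //=; case: eqP.
Qed.

End PolyF2.

(** The first n factors of f_c; in characteristic 2 the sign is immaterial. *)
Definition eulerP (c n : nat) : {poly 'F_2} := \prod_(0 <= i < n) (1 + 'X^(c * i.+1)).

(* In characteristic 2 these are D. Shanks' finite forms of the theorems of
   Gauss on triangular numbers and of Euler on pentagonal numbers; the partial
   sums of the increments in n telescope. *)
Section Shanks.

Let D n : {poly 'F_2} := \prod_(0 <= i < n) (1 + 'X^(i.*2.+1)).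
Let E s n : {poly 'F_2} := \prod_(s <= i < n) (1 + 'X^(i.*2.+2)).

(** With T_n(s) the summand of [shanks_gauss], the summand here is T_(n+1)(s) + (1 + X^(2 n + 1))
    T_n(s), where the factor is the ratio of D (n + 1) to D n. *)
Lemma shanks_gauss_step n k : (k <= n)%N ->
  \sum_(0 <= s < k.+1) D s * E s n * 'X^(s * n.*2.+1) *
     ((1 + 'X^(n.*2.+2)) * 'X^(s.*2) + 1 + 'X^(n.*2.+1)) =
  D k.+1 * E k n * 'X^(k.+1 * n.*2.+1).
Proof.
elim: k => [|k IHk] lekn.
  rewrite big_nat1 /D big_nil big_nat1 mul0n mul1n !expr0 /= !mul1r.
  rewrite (exprS 'X n.*2.+1) expr1.
  by apply: (@eq_add2 _ _ (E 0 n)); ring.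
rewrite big_nat_recr //= IHk; last exact: ltnW.
rewrite /E (big_ltn lekn) -/(E k.+1 n) -/(E _ _).
rewrite [D k.+2]/D big_nat_recr //= -/(D k.+1).
rewrite (_ : (k.+2 * n.*2.+1 = k.+1 * n.*2.+1 + n.*2.+1)%N); last by rewrite mulSnr.
rewrite doubleS !(exprS 'X n.*2.+1) !(exprS 'X k.*2.+2) !(exprS 'X k.*2.+1) exprD.
set a := 'X^(k.+1 * _); set b := 'X^(n.*2.+1); set c := 'X^(k.*2.+1).
by apply: (@eq_add2 _ _ (D k.+1 * E k.+1 n * a * (1 + 'X * c))); rewrite /= ; ring.
Qed.

Lemma shanks_gauss n :
  \sum_(0 <= s < n.+1) D s * E s n * 'X^(s * n.*2.+1) =
  D n * \sum_(0 <= s < n.*2.+1) 'X^(tri s).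
Proof.
elim: n => [|n IHn].
  by rewrite /= !big_nat1 /D /E !big_geq // mul0n /tri /= expr0; ring.
have recD : D n.+1 = D n * (1 + 'X^(n.*2.+1)) by rewrite /D big_nat_recr.
have := shanks_gauss_step (leqnn n); rewrite [E n n]big_geq // mulr1.
under eq_bigr do rewrite -addrA mulrDr.
rewrite big_split /= -mulr_suml IHn.
set S := \sum_(0 <= s < n.+1) _ => def_S.
rewrite big_nat_recr //= [E n.+1 n.+1]big_geq // mulr1.
have -> : \sum_(0 <= s < n.+1) D s * E s n.+1 * 'X^(s * n.*2.+3) = S.
  apply: eq_big_nat => s /andP[_ les]; rewrite {1}/E big_nat_recr //= -/(E s n).
  rewrite (_ : (s * n.*2.+3 = s * n.*2.+1 + s.*2)%N); last by rewrite -!muln2; ring.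
  by rewrite exprD; ring.
rewrite doubleS (@big_nat_recr _ _ _ n.*2.+2) //= (@big_nat_recr _ _ _ n.*2.+1) //=.
(* The two new triangular exponents are those of the telescoped boundary term and of the new summand
   s = n + 1. *)
have -> : tri n.*2.+1 = (n.+1 * n.*2.+1)%N.
  by rewrite /tri (_ : n.*2.+2 = n.+1.*2) // -doubleMr doubleK mulnC.
have -> : tri n.*2.+2 = (n.+1 * n.*2.+3)%N.
  by rewrite /tri (_ : n.*2.+2 = n.+1.*2) // -doubleMl doubleK.
have -> : S = D n.+1 * 'X^(n.+1 * n.*2.+1) +
    D n * (\sum_(0 <= s < n.*2.+1) 'X^(tri s)) * (1 + 'X^(n.*2.+1)).
  by rewrite -def_S -addrA addpp addr0.
by rewrite recD; ring.
Qed.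

End Shanks.

Section ShanksEuler.
Let F s n : {poly 'F_2} := \prod_(s <= i < n) (1 + 'X^(i.+1)).

(** The summand adds those of [shanks_euler] for n + 1 and for n, which is their difference in
    characteristic 2. *)
Lemma shanks_euler_step n k : (k <= n)%N ->
  \sum_(0 <= s < k.+1) F s n * 'X^(s * n + tri s) * ((1 + 'X^(n.+1)) * 'X^s + 1) =
  F k n * 'X^(k.+1 * n + tri k.+1).
Proof.
elim: k => [|k IHk] lekn.
  rewrite big_nat1 mul0n mul1n (_ : tri 1 = 1%N) // (_ : tri 0 = 0%N) // !expr0 addn1.
  by apply: (@eq_add2 _ _ (F 0 n)); ring.
rewrite big_nat_recr //= IHk; last exact: ltnW.
rewrite /F (big_ltn lekn) -/(F k.+1 n).
rewrite (triS k.+1) (_ : (k.+2 * n + _ = (k.+1 * n + tri k.+1) + (k.+1 + n.+1))%N); last by ring.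
rewrite [X in _ = _ * X]exprD [X in _ = _ * (_ * X)]exprD.
by apply: (@eq_add2 _ _ (F k.+1 n * 'X^(k.+1 * n + tri k.+1) * (1 + 'X^(k.+1)))); ring.
Qed.

Lemma shanks_euler n :
  \sum_(0 <= s < n.+1) F s n * 'X^(s * n + tri s) =
  1 + \sum_(0 <= s < n) ('X^(s.+1 * s + tri s.+1) + 'X^(s.+1 * s.+1 + tri s.+1)).
Proof.
elim: n => [|n IHn].
  by rewrite big_nat1 /F !big_geq // /tri expr0 mul1r addr0.
have := shanks_euler_step (leqnn n); rewrite [F n n]big_geq // mul1r.
under eq_bigr do rewrite mulrDr mulr1.
rewrite big_split /= IHn.
set S := \sum_(0 <= s < n.+1) _ => def_S.
rewrite big_nat_recr //= [F n.+1 n.+1]big_geq // mul1r.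
have -> : \sum_(0 <= s < n.+1) F s n.+1 * 'X^(s * n.+1 + tri s) = S.
  apply: eq_big_nat => s /andP[_ les]; rewrite {1}/F big_nat_recr //= -/(F s n).
  rewrite (_ : (s * n.+1 + tri s = s * n + tri s + s)%N); last by ring.
  by rewrite exprD; ring.
rewrite big_nat_recr //= -def_S.
set T := \sum_(0 <= s < n) _ in def_S *.
by apply: (@eq_add2 _ _ (-(1 + T))); rewrite /=; ring.
Qed.

End ShanksEuler.

(* Triangular numbers are written (x^2 - 1) / 8 with x odd, and generalised
   pentagonal numbers (y^2 - 1) / 24 with y prime to 6. *)
Definition psi (B : nat) : {poly 'F_2} :=
  \sum_(0 <= x < B | odd x) 'X^((x ^ 2 - 1) %/ 8).

Definition pent (B : nat) : {poly 'F_2} :=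
  \sum_(0 <= y < B | odd y && ~~ (3 %| y)%N) 'X^((y ^ 2 - 1) %/ 24).

Lemma sqr_sub1_div8 x : odd x -> (x ^ 2 = 8 * ((x ^ 2 - 1) %/ 8) + 1)%N.
Proof. by move=> ox; have := sqr_mod8 x; rewrite ox; move: (x ^ 2)%N; lia. Qed.

Lemma sqr_sub1_div24 y : odd y -> ~~ (3 %| y)%N -> (y ^ 2 = 24 * ((y ^ 2 - 1) %/ 24) + 1)%N.
Proof.
move=> oy y3; have := sqr_mod8 y; rewrite oy.
have : (y ^ 2 %% 3 = 1)%N.
  by rewrite sqr_mod3 y3.
by move: (y ^ 2)%N; lia.
Qed.

Lemma sum_tri n : \sum_(0 <= s < n) 'X^(tri s) = psi n.*2.
Proof.
rewrite /psi [RHS]big_mkcond; elim: n => [|n IHn]; first by rewrite !big_geq.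
rewrite doubleS !big_nat_recr //= IHn odd_double addr0 /=; congr (_ + 'X^_).
have : ((n.*2.+1) ^ 2 = 4 * (n * n.+1) + 1)%N by rewrite -mul2n; ring.
move=> ->; rewrite addnK /tri (_ : 8 = 4 * 2)%N // divnMA mulKn // divn2 //.
Qed.

Lemma sum_pent n :
  1 + \sum_(0 <= s < n) ('X^(s.+1 * s + tri s.+1) + 'X^(s.+1 * s.+1 + tri s.+1)) =
  pent (6 * n + 4).
Proof.
rewrite /pent [RHS]big_mkcond; elim: n => [|n IHn].
  by rewrite [\sum_(0 <= s < 0) _]big_geq // unlock /=
    (_ : (1 ^ 2 - 1) %/ 24 = 0)%N // expr0 !(add0r, addr0).
rewrite (_ : (6 * n.+1 + 4 = (6 * n + 4).+1.+1.+1.+1.+1.+1)%N); last by ring.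
rewrite [\sum_(0 <= s < n.+1) _]big_nat_recr //= addrA IHn.
pose c i : {poly 'F_2} := if odd i && ~~ (3 %| i)%N then 'X^((i ^ 2 - 1) %/ 24) else 0.
rewrite -[RHS]/(\sum_(0 <= i < _) c i) -[X in X + _]/(\sum_(0 <= i < _) c i).
have tri2 : (2 * tri n.+1 = n.+1 * n.+2)%N.
  by rewrite /tri mul2n halfK oddM /= negbK; case: odd => //=; rewrite subn0.
(* Among the six integers from 6 n + 4 on, only 6 n + 5 and 6 n + 7 are prime to 6. *)
have c0 j : (j \in [:: 0; 2; 4; 5])%N -> c (j + (6 * n + 4))%N = 0.
  by rewrite /c !inE; case: ifP => //; lia.
have c1 : c (1 + (6 * n + 4))%N = 'X^(n.+1 * n + tri n.+1).
  rewrite /c ifT; last lia.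
  have -> : ((1 + (6 * n + 4)) ^ 2 = 24 * (n.+1 * n + tri n.+1) + 1)%N.
    by move: tri2; move: (tri _) => t; nia.
  by rewrite addnK mulKn.
have c3 : c (3 + (6 * n + 4))%N = 'X^(n.+1 * n.+1 + tri n.+1).
  rewrite /c ifT; last lia.
  have -> : ((3 + (6 * n + 4)) ^ 2 = 24 * (n.+1 * n.+1 + tri n.+1) + 1)%N.
    by move: tri2; move: (tri _) => t; nia.
  by rewrite addnK mulKn.
do 6 rewrite [in RHS]big_nat_recr //.
rewrite (c0 0%N) // (c0 2%N) // (c0 4%N) // (c0 5%N) // c1 c3 /=.
by rewrite !addr0 addrA.
Qed.

(** * Euler products as theta series *)

Lemma eulerP_coef0 c n : (0 < c)%N -> (eulerP c n)`_0 = 1.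
Proof.
move=> c0; rewrite -horner_coef0 horner_prod big1 // => i _.
by rewrite !hornerE expr0n muln_eq0 eqn0Ngt c0 addr0.
Qed.

Lemma eulerP_comp c d n : eulerP c n \Po 'X^d = eulerP (d * c) n.
Proof.
rewrite /eulerP rmorph_prod; apply: eq_bigr => i _.
by rewrite rmorphD rmorph1 /= comp_polyXnXn mulnA.
Qed.

Lemma eulerP_sqr c n : eulerP c n ^+ 2 = eulerP (2 * c) n.
Proof. by rewrite sqrpE eulerP_comp. Qed.

Lemma eqmX_eulerP c m n : (m <= n)%N -> eqmX (c * m.+1) (eulerP c n) (eulerP c m).
Proof.
move=> lemn; rewrite /eulerP (big_cat_nat (n := m)) //= -[X in eqmX _ _ X]mulr1.
apply: eqmXM; first exact: eqmXxx.
rewrite big_nat_cond; elim/big_ind: _ => [|p q ? ?|x /andP[/andP[leBx _] _]].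
- exact: eqmXxx.
- by rewrite -[1]mulr1 eqmXM.
by rewrite /eqmX addrC addKr dvdp_exp2l // leq_mul2l ltnS leBx orbT.
Qed.

Lemma eqmX_sum_head N n (F : nat -> {poly 'F_2}) :
  (forall s, eqmX N (F s.+1) 0) -> eqmX N (\sum_(0 <= s < n.+1) F s) (F 0).
Proof.
move=> F0; rewrite big_nat_recl // -[X in eqmX _ _ X]addr0 eqmXD ?eqmXxx //.
elim/big_ind: _ => // [|p q ? ?]; first exact: eqmXxx.
by rewrite -[0]addr0 eqmXD.
Qed.

Lemma eqmX_Xn0 N p k : (N <= k)%N -> eqmX N (p * 'X^k) 0.
Proof. by move=> leNk; rewrite /eqmX subr0 dvdp_mull // dvdp_exp2l. Qed.

(** In Shanks' sum the terms with s > 0 have exponent s n + tri(s) > n, so only the full product at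
    s = 0 remains. *)
Lemma eqmX_euler n : eqmX n.+1 (eulerP 1 n) (pent (6 * n + 4)).
Proof.
rewrite -sum_pent -shanks_euler; apply: eqmX_sym.
apply: eqmX_trans (eqmX_sum_head _ _) _ => [s|].
  by apply: eqmX_Xn0; rewrite triS; lia.
rewrite mul0n expr0 mulr1 /eulerP.
by under [X in eqmX _ _ X]eq_bigr do rewrite mul1n; exact: eqmXxx.
Qed.

(** Up to precision, Shanks' sum is its term E at s = 0, so D psi = E. Multiplying by E gives f psi
    = E^2, and E = f_2 = f^2 modulo 2, whence f psi = f^4. *)
Lemma eqmX_gauss n : eqmX n.*2.+1 (eulerP 1 n.*2 ^+ 3) (psi n.*2.+1.*2).
Proof.
set f := eulerP 1 n.*2.
have f_split : \prod_(0 <= i < n) (1 + 'X^(i.*2.+1)) * \prod_(0 <= i < n) (1 + 'X^(i.*2.+2)) = f.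
  rewrite /f /eulerP; elim: (n) => [|k IHk]; first by rewrite !big_geq ?mulr1.
  by rewrite doubleS !big_nat_recr //= -IHk !mul1n; ring.
have E_eq : \prod_(0 <= i < n) (1 + 'X^(i.*2.+2)) = eulerP 1 n ^+ 2 :> {poly 'F_2}.
  by rewrite eulerP_sqr; apply: eq_bigr => i _; rewrite muln1 mul2n.
apply: (@eqmX_cancel _ f); first exact: eulerP_coef0.
rewrite -exprS -sum_tri -f_split mulrAC -shanks_gauss f_split E_eq.
apply: eqmX_sym; apply: (@eqmX_trans _ (eulerP 1 n ^+ 2 * eulerP 1 n ^+ 2)).
  apply: eqmXM; last exact: eqmXxx.
  apply: eqmX_trans (eqmX_sum_head _ _) _ => [s|].
    by apply: eqmX_Xn0; rewrite mulSn leq_addr.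
  by rewrite mul0n expr0 mulr1 big_geq // mul1r E_eq eqmXxx.
rewrite -exprD (_ : 2 + 2 = 2 * 2)%N // (_ : 4 = 2 * 2)%N // !exprM !eulerP_sqr.
apply/eqmX_sym/(eqmX_leq _ (@eqmX_eulerP _ n _ _)); rewrite -?addnn ?leq_addr //; lia.
Qed.

(** * The relation between psi(q) and psi(q^3), and dissection by parity *)

Lemma comp_sumXn (P : pred nat) (e : nat -> nat) B k :
  (\sum_(0 <= x < B | P x) 'X^(e x)) \Po 'X^k = \sum_(0 <= x < B | P x) 'X^(k * e x) :> {poly 'F_2}.
Proof. by rewrite rmorph_sum; apply: eq_bigr => x _; rewrite /= comp_polyXnXn. Qed.

Lemma pow4E (p : {poly 'F_2}) : p ^+ 4 = p \Po 'X^4.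
Proof.
have -> : p ^+ 4 = (p ^+ 2) ^+ 2 by rewrite -exprM.
by rewrite [LHS]sqrpE (sqrpE p) -comp_polyA comp_polyXnXn. Qed.

(** The exponents (x^2 - 1) / 8 and 3 (y^2 - 1) / 8 add up to n exactly when x^2 + 3 y^2 = 8 n + 4,
    so [odd_sqr3_reps] compares the coefficients. *)
Lemma psi_rel N B : (8 * N + 4 < B)%N ->
  eqmX N (psi B * (psi B \Po 'X^3)) (psi B ^+ 4 + 'X * (psi B \Po 'X^3) ^+ 4).
Proof.
move=> ltNB; apply/eqmXP => n ltnN.
rewrite (pow4E (psi B)) (pow4E (_ \Po _)) -comp_polyA comp_polyXnXn !comp_sumXn.
rewrite coef_sumXnM coefD coef_sumXn mulr_sumr.
rewrite (eq_bigr (fun x => 'X^((4 * 3 * ((x ^ 2 - 1) %/ 8)).+1)));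
  last by move=> x _; rewrite exprS.
rewrite coef_sumXn -natrD natrF2 [RHS]natrF2 oddD; congr (_ %:R); congr nat_of_bool.
have ltnB : (8 * n + 4 < B)%N by lia.
have := odd_sqr3_reps ltnB; rewrite /sqr3_reps.
congr (odd (size _) = odd _ (+) odd _); rewrite /pairs.
- apply: eq_filter => -[x y] /=.
  case ox: (odd x) => //=; case oy: (odd y) => //=.
  have := sqr_sub1_div8 ox; have := sqr_sub1_div8 oy.
  by move: (x ^ 2 - 1)%N (y ^ 2 - 1)%N; lia.
- by apply: eq_count => x /=; case ox: (odd x) => //=; have := sqr_sub1_div8 ox; lia.
by apply: eq_count => x /=; case ox: (odd x) => //=; have := sqr_sub1_div8 ox; lia.
Qed.

(** Squares are series in X^2, so S^2 carries the even exponents and X T^2 the odd ones. *)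
Lemma coef_sqr_add N (B S T : {poly 'F_2}) n : eqmX N B (S ^+ 2 + 'X * T ^+ 2) -> (n < N)%N ->
  B`_n = if odd n then T`_n./2 else S`_n./2.
Proof.
move=> /eqmXP eqB /eqB ->; rewrite (sqrpE S) (sqrpE T) coefD coefXM !coef_comp_poly_Xn //.
rewrite !dvdn2 !divn2; case: n => [|n] /=; first by rewrite addr0.
by case on: (odd n) => /=; rewrite ?addr0 ?add0r // uphalf_half on.
Qed.

Lemma dissection8 N (A g ps : {poly 'F_2}) m : g`_0 = 1 -> ps`_0 = 1 ->
    eqmX N (A * ps) g -> eqmX N (ps * g ^+ 3) (ps ^+ 4 + 'X * g ^+ 12) ->
    (8 * m + 3 < N)%N ->
  A`_(8 * m + 3) = (g ^+ 2 * ps)`_m.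
Proof.
move=> g0 ps0 defA rel ltmN.
(* [I] and [J] invert psi and g, so P = psi / g and Q = g^5 / psi. *)
have [I invI] := eqmX_inv N ps0; have [J invJ] := eqmX_inv N g0.
pose P := ps * J; pose Q := g ^+ 5 * I.
have A_PQ : eqmX N A (P ^+ 2 + 'X * Q ^+ 2).
  apply: (@eqmX_cancel _ (ps ^+ 2 * g ^+ 2)).
    by rewrite -horner_coef0 hornerM !horner_exp !horner_coef0 g0 ps0 !expr1n mulr1.
  apply: (@eqmX_trans _ (ps * g ^+ 3)).
    rewrite (_ : _ * A = ps * g ^+ 2 * (A * ps)); last by ring.
    by rewrite (exprSr g 2) [X in eqmX _ _ X]mulrA eqmXM ?eqmXxx.
  apply: eqmX_trans rel _; apply: eqmX_sym.
  rewrite (_ : _ * (_ + _) = ps ^+ 4 * (g * J) ^+ 2 + 'X * g ^+ 12 * (ps * I) ^+ 2);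
    last by rewrite /P /Q; ring.
  rewrite -[X in eqmX _ _ (X + _)]mulr1 -[X in eqmX _ _ (_ + X)]mulr1.
  rewrite -[in X in eqmX _ _ X](expr1n _ 2).
  by rewrite eqmXD ?eqmXM ?eqmXX ?eqmXxx.
have Q_A : eqmX N Q (g ^+ 4 * A).
  apply: (eqmX_cancel ps0); rewrite (_ : ps * Q = g ^+ 5 * (ps * I)); last by rewrite /Q; ring.
  rewrite (_ : ps * (_ * A) = g ^+ 4 * (A * ps)); last by ring.
  apply: (@eqmX_trans _ (g ^+ 5)); first by rewrite -[X in eqmX _ _ X]mulr1 eqmXM ?eqmXxx.
  by apply: eqmX_sym; rewrite (exprSr g 4) eqmXM ?eqmXxx.
have sqrA R : eqmX N (R ^+ 2 * A) ((R * P) ^+ 2 + 'X * (R * Q) ^+ 2).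
  rewrite (_ : _ + _ = R ^+ 2 * (P ^+ 2 + 'X * Q ^+ 2)); last by ring.
  by rewrite eqmXM ?eqmXxx.
(* The index goes from 8 m + 3 in A to 4 m + 1 in Q = g^4 A, then to 2 m in g^2 Q = g^6 A, then to m
   in g^3 P = g^2 psi. *)
rewrite (coef_sqr_add A_PQ) // ifT; last lia.
rewrite (_ : (8 * m + 3)./2 = 4 * m + 1)%N; last lia.
have /eqmXP -> // : eqmX N Q ((g ^+ 2) ^+ 2 * A) by rewrite -exprM.
  rewrite (coef_sqr_add (sqrA _)); last lia.
  rewrite ifT; last lia; rewrite (_ : (4 * m + 1)./2 = 2 * m)%N; last lia.
  have /eqmXP -> // : eqmX N (g ^+ 2 * Q) ((g ^+ 3) ^+ 2 * A).
    by rewrite -exprM (exprD g 2 4) -mulrA eqmXM ?eqmXxx.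
  - rewrite (coef_sqr_add (sqrA _)); last lia.
    rewrite ifF; last lia; rewrite (_ : (2 * m)./2 = m)%N; last lia.
    have /eqmXP -> // : eqmX N (g ^+ 3 * P) (g ^+ 2 * ps); last lia.
    rewrite (_ : _ * P = g ^+ 2 * ps * (g * J)); last by rewrite /P; ring.
    by rewrite -[X in eqmX _ _ X]mulr1 eqmXM ?eqmXxx.
  - lia.
lia.
Qed.

(** * The generating function of the partitions *)

Definition odd_partsP (N k : nat) : {poly 'F_2} :=
  \poly_(n < N) (size (odd_parts N k n))%:R.

Lemma odd_partsP_step N k :
  eqmX N (odd_partsP N k.+1)
    (odd_partsP N k * (1 + \sum_(0 <= t < N) 'X^(t.*2.+1 * k.+1))).
Proof.
apply/eqmXP => n ltnN; rewrite mulrDr mulr1 mulr_sumr coefD coef_sum !coef_poly ltnN.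
rewrite /= size_cat natrD size_allpairs_dep sumnE big_map natr_sum; congr (_ + _).
rewrite /index_iota subn0; apply: eq_bigr => t _; rewrite coefMXn coef_poly ltnNge.
by case: ifP => //= le_n; rewrite ifT //; lia.
Qed.

Lemma sum_odd_powers N (y : {poly 'F_2}) :
  (1 + y ^+ 2) * \sum_(0 <= t < N) y ^+ t.*2.+1 = y + y ^+ N.*2.+1.
Proof.
elim: N => [|N IHN]; first by rewrite big_geq // mulr0 addpp.
rewrite big_nat_recr //= mulrDr IHN doubleS !(exprS y N.*2.+2) !(exprS y N.*2.+1).
by apply: (@eq_add2 _ _ (y ^+ N.*2.+1)); ring.
Qed.

(** With y = X^i, the factor 1 + y / (1 - y^2) equals (1 + y + y^2) / (1 + y)^2 modulo 2, and (1 + y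
    + y^2) (1 + y) = 1 + y^3. *)
Lemma eqmX_odd_partsP N k : (0 < N)%N ->
  eqmX N (odd_partsP N k * eulerP 1 k ^+ 3) (eulerP 3 k).
Proof.
move=> N0; elim: k => [|k IHk].
  rewrite /eulerP !big_geq // expr1n mulr1; apply/eqmXP => n ltnN.
  by rewrite coef_poly ltnN coef1 /=; case: n ltnN.
rewrite /eulerP !big_nat_recr //= -/(eulerP 1 k) -/(eulerP 3 k) mul1n.
rewrite (mulnC 3) exprM; set y := 'X^(k.+1); set S := 1 + \sum_(0 <= t < N) y ^+ t.*2.+1.
have S_eq : eqmX N ((1 + y) ^+ 2 * S) (1 + y + y ^+ 2).
  have -> : (1 + y) ^+ 2 * S = (1 + y + y ^+ 2) + y ^+ N.*2.+1.
    have -> : (1 + y) ^+ 2 = 1 + y ^+ 2 by apply: (@eq_add2 _ _ y); ring.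
    by rewrite /S mulrDr sum_odd_powers; ring.
  rewrite -[X in eqmX _ _ X]addr0 eqmXD ?eqmXxx // -[_ ^+ _]mul1r -exprM eqmX_Xn0 //.
  by rewrite -addnn; nia.
have P_eq : eqmX N (odd_partsP N k.+1) (odd_partsP N k * S).
  apply: eqmX_trans (odd_partsP_step N k) _.
  by under eq_bigr do rewrite mulnC exprM; apply: eqmXxx.
apply: (@eqmX_trans _ (odd_partsP N k * S * (eulerP 1 k * (1 + y)) ^+ 3)).
  by apply: eqmXM => //; apply: eqmXxx.
rewrite (_ : _ * _ = (odd_partsP N k * eulerP 1 k ^+ 3) * (((1 + y) ^+ 2 * S) * (1 + y)));
  last by ring.
apply: eqmXM => //.
have -> : 1 + y ^+ 3 = (1 + y + y ^+ 2) * (1 + y) by apply/esym/(@eq_add2 _ _ (y + y ^+ 2)); ring.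
by apply: eqmXM => //; apply: eqmXxx.
Qed.

(** * The coefficients at 8 m + 3 *)

Lemma coef_pent_psi m B : (8 * m + 3 < B)%N ->
  ((psi B) * (pent B \Po 'X^6))`_m = (size (sqr2_reps_ndvd3 (8 * m + 3)))%:R.
Proof.
move=> ltmB; rewrite comp_sumXn coef_sumXnM; congr (_%:R).
apply/perm_size/uniq_perm; first exact: pairs_uniq.
  by rewrite filter_uniq // sqr2_reps_uniq.
case=> x y; rewrite mem_pairs [_ \in sqr2_reps_ndvd3 _]mem_filter mem_sqr2_reps ?addn_gt0 ?orbT //=.
(* Multiplied by 8, (x^2 - 1) / 8 + 6 (y^2 - 1) / 24 = m reads x^2 + 2 y^2 = 8 m + 3; conversely
   this equation modulo 8 forces x and y to be odd. *)
apply/idP/idP => [/andP[/and3P[ox /andP[oy y3] /eqP def_m] _] | /andP[y3 /eqP def_m]].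
  rewrite y3 /=; apply/eqP; rewrite -def_m.
  have := sqr_sub1_div8 ox; have := sqr_sub1_div24 oy y3.
  by move: ((x ^ 2 - 1) %/ 8)%N ((y ^ 2 - 1) %/ 24)%N (x ^ 2)%N (y ^ 2)%N; lia.
have ox : odd x.
  have := sqr_mod8 x; case: (odd x) => //.
  by move: (x ^ 2)%N (y ^ 2)%N def_m; case: odd; lia.
have oy : odd y.
  have := sqr_mod8 x; have := sqr_mod8 y; rewrite ox; case: (odd y) => //.
  by move: (x ^ 2)%N (y ^ 2)%N def_m; case: odd; lia.
rewrite ox oy y3 /=; have := sqr_sub1_div8 ox; have := sqr_sub1_div24 oy y3.
have := odd_gt0 ox; have := odd_gt0 oy.
by move: ((x ^ 2 - 1) %/ 8)%N ((y ^ 2 - 1) %/ 24)%N => a b; nia.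
Qed.

Lemma odd_num_odd_mult_partitions m :
  odd (num_odd_mult_partitions (8 * m + 3)) = odd (size (sqr2_reps_ndvd3 (8 * m + 3))).
Proof.
suff: (num_odd_mult_partitions (8 * m + 3))%:R = (size (sqr2_reps_ndvd3 (8 * m + 3)))%:R :> 'F_2.
  by rewrite natrF2 [RHS]natrF2; case: odd; case: odd.
(* [eqmX_gauss] asks for an even number of factors, the precision N must exceed 8 m + 3, and B is
   the least bound that [psi_rel] admits. *)
pose M := (4 * m + 2).*2; pose N := M.+1; pose B := (8 * N + 5)%N.
have def_M : M = (8 * m + 4)%N by rewrite /M -mul2n; lia.
set f := eulerP 1 M; set g := eulerP 3 M.
have f3 : eqmX N (f ^+ 3) (psi B).
  apply: eqmX_trans (eqmX_gauss _) _; apply: eqmX_sym.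
  apply: eqmX_sum_range => [x le_x ox|]; last by rewrite -/M -/N /B; lia.
  have {}le_x : (M.*2.+3 <= x)%N.
    rewrite ltn_neqAle -doubleS le_x andbT.
    by apply: contraTneq ox => <-; rewrite odd_double.
  by rewrite leq_divRL // /N; nia.
have gE : g = f \Po 'X^3 by rewrite eulerP_comp.
have g3 : eqmX N (g ^+ 3) (psi B \Po 'X^3).
  rewrite gE -rmorphXn; apply: eqmX_leq (eqmX_comp 3 f3); lia.
have rel : eqmX N (f ^+ 3 * g ^+ 3) ((f ^+ 3) ^+ 4 + 'X * g ^+ 12).
  apply: eqmX_trans (eqmXM f3 g3) _; apply: eqmX_trans (psi_rel _) _; first by rewrite /B; lia.
  apply: eqmX_sym; rewrite -[12%N]/(3 * 4)%N exprM.
  by apply: eqmXD; [apply: eqmXX | apply: eqmXM; [apply: eqmXxx | apply: eqmXX]].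
(* Modulo 2, f_3^2 = f_6 is f_1 taken at X^6, to which Euler's theorem applies. *)
have g2 : eqmX N (g ^+ 2) (pent B \Po 'X^6).
  rewrite eulerP_sqr -(eulerP_comp 1 6); apply: (eqmX_leq (N := 6 * N)); first lia.
  apply: eqmX_comp; apply: eqmX_trans (eqmX_euler _) _; apply: eqmX_sym.
  apply: eqmX_sum_range => [y le_y _|]; last by rewrite /B /N; lia.
  by rewrite leq_divRL // /N; nia.
have f0 : (f ^+ 3)`_0 = 1.
  by rewrite -horner_coef0 horner_exp horner_coef0 eulerP_coef0 // expr1n.
have ltN : (8 * m + 3 < N)%N by rewrite /N def_M; lia.
have := @dissection8 N (odd_partsP N M) g (f ^+ 3) m (@eulerP_coef0 3 M isT) f0
  (@eqmX_odd_partsP N M isT) rel ltN.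
rewrite coef_poly ltN size_odd_parts //.
move=> ->; rewrite mulrC -(@coef_pent_psi m B); last by rewrite /B /N def_M; lia.
by have /eqmXP -> := eqmXM f3 g2; rewrite // /N def_M; lia.
Qed.

End PowerSeriesModTwo.

Theorem theorem2p8 (m : nat) :
  odd (num_odd_mult_partitions (8 * m + 3)) <->
    (m = 0 %[mod 3] /\ exists k : nat, 8 * m + 3 = 3 * k ^ 2)
    \/
    (m = 1 %[mod 3] /\
     exists p : nat,
       [/\ prime p,
           logn p (8 * m + 3) = 1 %[mod 4] &
           forall r : nat, prime r -> r <> p -> ~~ odd (logn r (8 * m + 3))]).
Proof.
rewrite odd_num_odd_mult_partitions odd_sqr2_reps_ndvd3; last lia.
(* Modulo 3, 8 m + 3 is 2 m. *)
have e0 : m = 0 %[mod 3] <-> (8 * m + 3) %% 3 = 0 by lia.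
have e1 : m = 1 %[mod 3] <-> (8 * m + 3) %% 3 = 2 by lia.
by rewrite e0 e1.
Qed.
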